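(* Let $y_d\in L^2(\omega_o)$ and assume the pre-dual Slater condition: there exist $h\in\operatorname{dom}{}^*S\subset L^2(\omega_o)$ and $\varepsilon>0$ such that $({}^*S h)(x)\ge\varepsilon$ for all $x\in\overline\omega_c$. Then the problem $$\min_{u\in\mathcal M(\overline\omega_c)}\ \tfrac12\|Su-y_d\|_{L^2(\omega_o)}^2+\delta_{\mathcal M(\overline\omega_c)^+}(u)$$ (the functional being $+\infty$ for $u\notin\operatorname{dom}S$) has a minimizer $\bar u\in\mathcal M(\overline\omega_c)$ with $S\bar u\in L^2(\omega_o)$. If $S$ is injective, the minimizer $\bar u$ is unique.
   Context: Setting. $\Omega\subset\mathbb R^d$ is a bounded domain (open, connected) with Lipschitz boundary. On $H^1(\Omega)\times H^1(\Omega)$ let $$a(y,p)=\int_\Omega\Big[\sum_{i,j=1}^d a_{ij}y_{x_i}p_{x_j}+c\,y\,p\Big]dx+\int_{\partial\Omega}r\,y\,p\,ds,$$ where $a_{ij}=a_{ji}\in L^\infty(\Omega)$, $\sum a_{ij}(x)\xi_i\xi_j\ge a_0|\xi|^2$ for some $a_0>0$, all $\xi\in\mathbb R^d$ and a.a. $x\in\Omega$, $0\le c\in L^\infty(\Omega)$, $0\le r\in L^\infty(\partial\Omega)$, and $c,r$ are not both identically $0$ (so $a$ is coercive on $H^1(\Omega)$). Fix $q>d$ with dual index $q'$, $1/q+1/q'=1$, $q'\le 2$. Operator $A$. Let $\operatorname{dom}{}^*A:=\{p\in H^1(\Omega):\exists c_p\in\mathbb R,\ a(y,p)\le c_p\|y\|_{W^{1,q'}(\Omega)}\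 \forall y\in H^1(\Omega)\}$ and for $p\in\operatorname{dom}{}^*A$ let ${}^*A p\in W^{1,q'}(\Omega)^*$ be the unique continuous extension of $y\mapsto a(y,p)$ from $H^1(\Omega)$ to $W^{1,q'}(\Omega)$. It is a standing assumption that $\operatorname{dom}{}^*A\subset C(\overline\Omega)$; then ${}^*A:C(\overline\Omega)\supset\operatorname{dom}{}^*A\to W^{1,q'}(\Omega)^*$ is closed, densely defined, bijective with continuous inverse. $A:=({}^*A)^*:W^{1,q'}(\Omega)\supset\operatorname{dom}A\to\mathcal M(\overline\Omega)=C(\overline\Omega)^*$ is its Banach space adjoint; it is closed and continuously invertible, and (known fact) $\mu_n\rightharpoonup^*\mu$ in $\mathcal M(\overline\Omega)$ implies $A^{-1}\mu_n\to A^{-1}\mu$ strongly in $W^{1,q'}(\Omega)$. Operator $B$. $\overline\omega_c\subset\overline\Omega$ is compact, carrying a positive bounded measure $\nu$ with $\nu(\overline\omega_c\cap O)>0$ for each open $O\subset\mathbb R^d$ with $\overline\omega_c\cap O\ne\emptyset$; $L^2(\overline\omega_c)$ is taken with respect to $\nu$ and regarded as a subspace of $\mathcal M(\overline\omega_c)=C(\overline\omega_c)^*$ (the Radon measures). ${}^*B:C(\overline\Omega)\to C(\overline\omega_c)$ is restriction, and it is assumed that there is a continuous operator ${}^*B_{H^1}:H^1(\Omega)\to L^2(\overline\omega_c)$ coinciding with ${}^*B$ on $C(\overline\Omega)\cap H^1(\Omega)$. $B:=({}^*B)^*:\mathcal M(\overline\omega_c)\to\mathcal M(\overline\Omega)$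 is extension by zero. Operator $E$. $\omega_o\subset\overline\Omega$ carries a suitable measure and $E:W^{1,q'}(\Omega)\supset\operatorname{dom}E\to L^2(\omega_o)$ is a closed, possibly unbounded, linear operator whose domain is dense and contains $H^1(\Omega)$. ${}^*E:=E^*:L^2(\omega_o)\supset\operatorname{dom}{}^*E\to W^{1,q'}(\Omega)^*$ (closed, densely defined). Operator $S$. ${}^*S:={}^*B\,({}^*A)^{-1}\,{}^*E:L^2(\omega_o)\supset\operatorname{dom}{}^*S:=\operatorname{dom}{}^*E\to C(\overline\omega_c)$ and $S:=({}^*S)^*:\mathcal M(\overline\omega_c)\supset\operatorname{dom}S\to L^2(\omega_o)$. $\mathcal M(\overline\omega_c)^+$ is the cone of non-negative measures, and $\delta_C$ denotes the indicator function ($0$ on $C$, $+\infty$ elsewhere). *)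

(* Defs.v *)
From HB Require Import structures.
From mathcomp Require Import all_boot all_order all_algebra.
From mathcomp Require Import all_classical all_reals all_analysis.
Set Implicit Arguments.
Unset Strict Implicit.
Unset Printing Implicit Defensive.
Import Order.TTheory GRing.Theory Num.Theory.
Import numFieldNormedType.Exports.
Local Open Scope classical_set_scope.
Local Open Scope ring_scope.

(* R^d, with the topology of row vectors and the Borel sigma-algebra. The norm
   inherited from ['rV_d] is the sup norm; [enorm] is the Euclidean one. *)
Definition Rd (R : realType) (d : nat) : Type := 'rV[R]_d.
HB.instance Definition _ (R : realType) (d : nat) :=
  NormedModule.copy (Rd R d) 'rV[R]_d.
HB.instance Definition _ (R : realType) (d : nat) :=
  Measurable.copy (Rd R d) (g_sigma_algebraType (@open 'rV[R]_d)).

Section Euclidean.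
Context (R : realType) (d : nat).
Implicit Types (x y a b : Rd R d) (A C Omega : set (Rd R d)).

Definition dot x y : R := \sum_(i < d) x 0 i * y 0 i.
Definition enorm x : R := Num.sqrt (dot x x).

Definition is_lebesgue (lam : {measure set (Rd R d) -> \bar R}) : Prop :=
  forall a b, (forall i, a 0 i <= b 0 i) ->
    lam [set x | forall i, a 0 i <= x 0 i <= b 0 i]
    = (\prod_(i < d) (b 0 i - a 0 i))%:E.

Definition is_lebesgue_on Omega (dx : {measure set (Rd R d) -> \bar R}) : Prop :=
  exists2 lam : {measure set (Rd R d) -> \bar R}, is_lebesgue lam &
    forall A, measurable A -> dx A = lam (A `&` Omega).

(* Volume of the Euclidean unit ball of R^n. *)
Fixpoint ball_volume (n : nat) : R :=
  match n with
  | 0 => 1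
  | 1 => 2
  | m.+2 => 2 * pi / m.+2%:R * ball_volume m
  end.

Definition diameter C : \bar R :=
  ereal_sup [set (enorm (x.1 - x.2))%:E | x in C `*` C].

Definition hausdorff_gauge (n : nat) C : \bar R :=
  if `[< C = set0 >] then 0%E
  else (ball_volume n * (fine (diameter C) / 2) ^+ n)%:E.

Definition hausdorff_delta (n : nat) (delta : R) A : \bar R :=
  ereal_inf [set (\sum_(0 <= k <oo) hausdorff_gauge n (C k))%E |
    C in [set C : (set (Rd R d))^nat | A `<=` \bigcup_k C k /\
            forall k, (diameter (C k) <= delta%:E)%E]].

(* n-dimensional Hausdorff outer measure, normalized to agree with the
   n-dimensional surface measure. *)
Definition hausdorff (n : nat) A : \bar R :=
  ereal_sup [set hausdorff_delta n delta A | delta in [set delta | 0 < delta]].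

Definition frontier A : set (Rd R d) := closure A `\` interior A.

Definition is_surface_measure Omega
    (ds : {measure set (Rd R d) -> \bar R}) : Prop :=
  forall A, measurable A -> ds A = hausdorff d.-1 (A `&` frontier Omega).

(* Near each boundary point, Omega is the part of a ball above the graph of a
   Lipschitz function of the coordinates orthogonal to a unit vector [e]. *)
Definition lipschitz_boundary Omega : Prop :=
  forall x0, frontier Omega x0 ->
  exists (e : Rd R d) (rho L : R) (g : Rd R d -> R),
    [/\ dot e e = 1, 0 < rho,
        (forall x y, `|g x - g y| <= L * enorm (x - y)) &
        forall x, enorm (x - x0) < rho ->
          (Omega x <-> g (x - dot x e *: e) < dot x e)].

Definition lipschitz_domain Omega : Prop :=
  [/\ Omega !=set0, open Omega, connected Omega, bounded_set Omega &
      lipschitz_boundary Omega].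

End Euclidean.

Section ContinuousFunctions.
Context (R : realType) (d : nat) (K : set (Rd R d)).

(* C(K): each function continuous on K is represented by its extension by zero
   to R^d, so that two elements are equal iff they agree on K. *)
Definition Cfun : {pred Rd R d -> R} :=
  mem [set f : Rd R d -> R | {within K, continuous f} /\
                             forall x, ~ K x -> f x = 0].

Lemma Cfun_submod_closed : submod_closed Cfun.
Proof.
split=> [|a f g]; first by rewrite inE; split=> // x; exact: cvg_cst.
rewrite !inE => -[cf f0] [cg g0]; split=> [x|x nKx]; last first.
  by rewrite !fctE f0// g0// scaler0 addr0.
by apply: (@cvgD _ _ _ _ _ (a \*: f) g); [apply: cvgZr; exact: cf|exact: cg].
Qed.

HB.instance Definition _ :=
  GRing.isSubmodClosed.Build R (Rd R d -> R) Cfun Cfun_submod_closed.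

Record contfun := Contfun {
  contfun_fun :> Rd R d -> R; contfun_subproof : contfun_fun \in Cfun }.

HB.instance Definition _ := [isSub for contfun_fun].
HB.instance Definition _ := [Choice of contfun by <:].
HB.instance Definition _ := [SubChoice_isSubLmodule of contfun by <:].

Definition supnorm (f : contfun) : R := sup [set `|f x| | x in K].

(* M(K) = C(K)^*. *)
Record radon := Radon {
  radon_fun :> {scalar contfun};
  radon_bounded : exists c : R, forall f, `|radon_fun f| <= c * supnorm f }.

(* The functionals of M(K) given by integration against a non-negative finite
   Borel measure on K. *)
Definition radon_nonneg (u : radon) : Prop :=
  exists m : {measure set (Rd R d) -> \bar R},
    [/\ (m [set: Rd R d] < +oo)%E, m.-negligible (~` K) &
        forall f : contfun, u f = \int[m]_x f x].

End ContinuousFunctions.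
Arguments contfun {R d} K.
Arguments radon {R d} K.

Section Sobolev.
Context (R : realType) (d : nat) (Omega : set (Rd R d)).
Variable dx : {measure set (Rd R d) -> \bar R}.
Implicit Types (f g phi : Rd R d -> R) (i : 'I_d) (p : R).

Fixpoint Ck (k : nat) (f : Rd R d -> R^o) : Prop :=
  match k with
  | 0 => continuous f
  | k'.+1 => continuous f /\
      forall v : Rd R d, (forall x, derivable f x v) /\ Ck k' ('D_v f)
  end.

Definition partial i phi : Rd R d -> R := 'D_(delta_mx 0 i : Rd R d) (phi : _ -> R^o).

Definition test_function phi : Prop :=
  (forall k, Ck k phi) /\
  exists K : set (Rd R d), [/\ compact K, K `<=` Omega &
                               forall x, ~ K x -> phi x = 0].

(* [dx] is the Lebesgue measure restricted to Omega, so integrals over the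
   whole type are integrals over Omega. *)
Definition weak_partial i f g : Prop :=
  forall phi, test_function phi ->
    \int[dx]_x (f x * partial i phi x) = - \int[dx]_x (g x * phi x).

Definition locally_L1 g : Prop :=
  measurable_fun [set: Rd R d] g /\
  forall K : set (Rd R d), compact K -> K `<=` Omega ->
    dx.-integrable K (EFin \o g).

(* The weak derivative of f in direction i; unique dx-almost everywhere when it
   exists. *)
Definition wD i f : Rd R d -> R :=
  xget (cst 0) [set g | locally_L1 g /\ weak_partial i f g].

(* Spaces of classes modulo equality dx-almost everywhere are handled through
   representatives R^d -> R. *)
Definition W1 p f : Prop :=
  f \in Lfun dx p%:E /\
  forall i, exists2 g, g \in Lfun dx p%:E & weak_partial i f g.

Definition W1norm p f : R :=
  (fine ('N[dx]_(p%:E)[EFin \o f]) `^ p +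
   \sum_(i < d) fine ('N[dx]_(p%:E)[EFin \o wD i f]) `^ p) `^ p^-1.

Definition W1dual p (phi : (Rd R d -> R) -> R) : Prop :=
  (forall (a : R) f g, W1 p f -> W1 p g ->
     phi (a *: f + g) = a * phi f + phi g) /\
  exists c : R, forall f, W1 p f -> `|phi f| <= c * W1norm p f.

(* T is a continuous linear operator H^1(Omega) -> L^2(m) that coincides with
   f |-> f on the intersection of C(closure Omega) and H^1(Omega). *)
Definition restriction_on_H1 (m : {measure set (Rd R d) -> \bar R})
    (T : (Rd R d -> R) -> Rd R d -> R) : Prop :=
  [/\ forall f, W1 2 f -> T f \in Lfun m 2%:E,
      forall (a : R) f g, W1 2 f -> W1 2 g ->
        T (a *: f + g) = a *: T f + T g %[ae m],
      exists c : R, forall f, W1 2 f ->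
        fine ('N[m]_(2%:E)[EFin \o T f]) <= c * W1norm 2 f &
      forall f (h : contfun (closure Omega)), W1 2 f ->
        f = h %[ae dx] -> T f = h %[ae m]].

(* E is the graph of a closed linear operator, possibly unbounded, from a
   subspace of W^{1,p}(Omega) to L^2(m). *)
Definition closed_operator p (m : {measure set (Rd R d) -> \bar R})
    (E : (Rd R d -> R) -> (Rd R d -> R) -> Prop) : Prop :=
  [/\ forall y z, E y z -> W1 p y /\ z \in Lfun m 2%:E,
      forall y z1 z2, E y z1 -> E y z2 -> z1 = z2 %[ae m],
      forall (a : R) y1 y2 z1 z2, E y1 z1 -> E y2 z2 ->
        E (a *: y1 + y2) (a *: z1 + z2) &
      forall (y_ z_ : nat -> Rd R d -> R) y z,
        (forall n, E (y_ n) (z_ n)) -> W1 p y -> z \in Lfun m 2%:E ->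
        W1norm p (y_ n - y) @[n --> \oo] --> (0 : R) ->
        fine ('N[m]_(2%:E)[EFin \o (z_ n - z)]) @[n --> \oo] --> (0 : R) ->
        E y z].

Definition densely_defined p (E : (Rd R d -> R) -> (Rd R d -> R) -> Prop) : Prop :=
  forall y, W1 p y -> forall eps : R, 0 < eps ->
    exists y' z', E y' z' /\ W1norm p (y' - y) < eps.

End Sobolev.

Record setting (R : realType) (d : nat) := Setting {
  Omega : set (Rd R d);
  dx : {measure set (Rd R d) -> \bar R}; (* volume measure of Omega *)
  ds : {measure set (Rd R d) -> \bar R}; (* surface measure of its boundary *)
  coef_a : 'I_d -> 'I_d -> Rd R d -> R;
  coef_c : Rd R d -> R;
  coef_r : Rd R d -> R;
  trace : (Rd R d -> R) -> Rd R d -> R; (* trace H^1(Omega) -> L^2(ds) *)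
  q : R;
  q' : R;
  omega_c : set (Rd R d);
  nu : {measure set (Rd R d) -> \bar R};
  omega_o : set (Rd R d);
  mu_o : {measure set (Rd R d) -> \bar R};
  opE : (Rd R d -> R) -> (Rd R d -> R) -> Prop (* graph *)
}.

Section Operators.
Context (R : realType) (d : nat) (P : setting R d).
Local Notation Omega := (Omega P).
Local Notation dx := (dx P).
Local Notation H1 := (W1 Omega dx 2).
Local Notation Wq' := (W1 Omega dx (q' P)).
Local Notation Wq'norm := (W1norm Omega dx (q' P)).
Local Notation Wq'dual := (W1dual Omega dx (q' P)).
Local Notation K := (omega_c P).
Implicit Types (y p h z : Rd R d -> R) (phi : (Rd R d -> R) -> R).

Definition bilin y p : R :=
  \int[dx]_x (\sum_(i < d) \sum_(j < d)
      coef_a P i j x * wD Omega dx i y x * wD Omega dx j p x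
    + coef_c P x * y x * p x)
  + \int[ds P]_x (coef_r P x * trace P y x * trace P p x).

Definition dom_starA p : Prop :=
  H1 p /\ exists c_p : R, forall y, H1 y -> bilin y p <= c_p * Wq'norm y.

(* Unbounded operators are given by their graphs; elements of W^{1,q'}(Omega)^*
   are functionals that only matter on W^{1,q'}(Omega). *)
Definition starA p phi : Prop :=
  [/\ dom_starA p, Wq'dual phi & forall y, H1 y -> phi y = bilin y p].

Definition starB (f : contfun (closure Omega)) (v : contfun K) : Prop :=
  forall x, K x -> v x = f x.

Definition starE h phi : Prop :=
  [/\ h \in Lfun (mu_o P) 2%:E, Wq'dual phi &
      forall y z, opE P y z -> phi y = \int[mu_o P]_x (h x * z x)].

(* *S = *B o ( *A)^-1 o *E. *)
Definition starS h (v : contfun K) : Prop :=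
  exists phi p (f : contfun (closure Omega)),
    [/\ starE h phi, starA p phi, p = f %[ae dx] & starB f v].

(* S = ( *S)^*. *)
Definition opS (u : radon K) z : Prop :=
  z \in Lfun (mu_o P) 2%:E /\
  forall h (v : contfun K), starS h v -> u v = \int[mu_o P]_x (h x * z x).

Definition dom_S (u : radon K) : Prop := exists z, opS u z.

Definition S_injective : Prop :=
  forall u1 u2 z, opS u1 z -> opS u2 z -> u1 = u2.

Record standing_assumptions : Prop := {
  dim_gt0 : (0 < d)%N;
  Omega_domain : lipschitz_domain Omega;
  dx_lebesgue : is_lebesgue_on Omega dx;
  ds_surface : is_surface_measure Omega (ds P);
  coef_a_Linf : forall i j, coef_a P i j \in Lfun dx +oo%E;
  coef_a_sym : forall i j, coef_a P i j = coef_a P j i %[ae dx];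
  coef_a_elliptic : exists2 a0 : R, 0 < a0 &
    \forall x \ae dx, forall xi : Rd R d,
      a0 * enorm xi ^+ 2 <=
        \sum_(i < d) \sum_(j < d) coef_a P i j x * xi 0 i * xi 0 j;
  coef_c_Linf : coef_c P \in Lfun dx +oo%E;
  coef_c_ge0 : \forall x \ae dx, 0 <= coef_c P x;
  coef_r_Linf : coef_r P \in Lfun (ds P) +oo%E;
  coef_r_ge0 : \forall x \ae (ds P), 0 <= coef_r P x;
  coef_cr_neq0 : ~ (coef_c P = cst 0 %[ae dx] /\ coef_r P = cst 0 %[ae (ds P)]);
  trace_restriction : restriction_on_H1 Omega dx (ds P) (trace P);
  q_gtd : d%:R < q P;
  q_conjugate : (q P)^-1 + (q' P)^-1 = 1;
  q'_le2 : q' P <= 2;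
  dom_starA_continuous : forall p, dom_starA p ->
    exists f : contfun (closure Omega), p = f %[ae dx];
  omega_c_compact : compact K;
  omega_c_sub : K `<=` closure Omega;
  nu_finite : (nu P [set: Rd R d] < +oo)%E;
  nu_on_omega_c : (nu P).-negligible (~` K);
  nu_support : forall O : set (Rd R d), open O -> K `&` O !=set0 ->
    (0 < nu P (K `&` O))%E;
  starB_H1 : exists T, restriction_on_H1 Omega dx (nu P) T;
  omega_o_sub : omega_o P `<=` closure Omega;
  mu_o_on_omega_o : (mu_o P).-negligible (~` omega_o P);
  E_closed : closed_operator Omega dx (q' P) (mu_o P) (opE P);
  E_dense : densely_defined Omega dx (q' P) (opE P);
  E_dom_H1 : forall y, H1 y -> exists z, opE P y z
}.

Definition predual_slater : Prop :=
  exists h (v : contfun K) (eps : R),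
    [/\ starS h v, 0 < eps & forall x, K x -> eps <= v x].

(* 1/2 |S u - y_d|^2, and +oo = inf set0 for u outside the domain of S. As S
   is an operator, the graph opS relates u to one class of L^2(omega_o) only,
   and all its representatives z give the same value. *)
Definition tracking (yd : Rd R d -> R) (u : radon K) : \bar R :=
  ereal_inf [set (2^-1 * fine ('N[mu_o P]_(2%:E)[EFin \o (z - yd)]) ^+ 2)%:E |
             z in opS u].

Definition indicator_nonneg (u : radon K) : \bar R :=
  if `[< radon_nonneg u >] then 0%E else +oo%E.

Definition objective (yd : Rd R d -> R) (u : radon K) : \bar R :=
  (tracking yd u + indicator_nonneg u)%E.

Definition minimizer (yd : Rd R d -> R) (u : radon K) : Prop :=
  forall w : radon K, (objective yd u <= objective yd w)%E.

End Operators.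

(* Main.v *)
(** The admissible pairs (u, z), z = S u, form a convex set, so by the
    parallelogram identity the states z_n of a minimizing sequence are Cauchy in
    L^2, hence converge strongly to some z. The Slater element v = *S h >= eps
    bounds the masses: eps u_n(1) <= u_n(v) = <h, z_n>. The functionals u_n
    therefore have a pointwise limit u along an ultrafilter, which is positive
    on C(K) and, by the Riesz-Markov theorem, a measure; passing to the limit in
    u_n(v) = <h, z_n> gives S u = z. Working with pairs makes it unnecessary to
    know that S is single-valued. For uniqueness, the midpoint of two optimal
    pairs shows that both have the same state.

    The Riesz-Markov measure is built by the Caratheodory method from the outer
    measure inf {sup_n u(F_n)}, over increasing sequences F_n in C(K) with
    F_n >= 0 that eventually dominate the indicator of the set. *)

Require Import Defs.
From HB Require Import structures.
From mathcomp Require Import all_boot all_order all_algebra.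
From mathcomp Require Import all_classical all_reals all_analysis.
From mathcomp Require Import measurable_realfun ring lra.
Set Implicit Arguments.
Unset Strict Implicit.
Unset Printing Implicit Defensive.
Import Order.TTheory GRing.Theory Num.Theory.
Import numFieldNormedType.Exports.
Local Open Scope classical_set_scope.
Local Open Scope ring_scope.

(** * The Riesz-Markov theorem on a compact set *)

Section ContfunLattice.
Context (R : realType) (d : nat) (K : set (Rd R d)).
Implicit Types f g : contfun K.

Lemma contfunP f : {within K, continuous f} /\ forall x, ~ K x -> f x = 0.
Proof. by have := contfun_subproof f; rewrite inE. Qed.

Lemma contfunM_subproof f g : (fun x => f x * g x) \in Cfun K.
Proof.
have [cf f0] := contfunP f; have [cg g0] := contfunP g.
rewrite inE; split=> [x|x nKx]; last by rewrite f0// mul0r.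
by apply: (@cvgM _ _ _ _ (f : _ -> R) (g : _ -> R)); [exact: cf|exact: cg].
Qed.

Definition contfun_mul f g : contfun K := Contfun (contfunM_subproof f g).

Lemma contfun_min_subproof f g : (fun x => Num.min (f x) (g x)) \in Cfun K.
Proof.
have [cf f0] := contfunP f; have [cg g0] := contfunP g.
rewrite inE; split=> [x|x nKx]; last by rewrite f0// g0// minxx.
by apply: continuous_min; [exact: cf|exact: cg].
Qed.

Definition contfun_min f g : contfun K := Contfun (contfun_min_subproof f g).

Lemma contfun_restrict_subproof (f : Rd R d -> R) :
  continuous f -> f \_ K \in Cfun K.
Proof.
move=> cf; rewrite inE; split=> [|x nKx]; last by rewrite /= /patch memNset.
apply: (@subspace_eq_continuous _ _ _ (f : subspace K -> R)).
  by move=> x xK; rewrite /from_subspace /= /patch xK.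
exact: continuous_subspaceT.
Qed.

Definition contfun_restrict (f : Rd R d -> R) (cf : continuous f) : contfun K :=
  Contfun (contfun_restrict_subproof cf).

Definition contfun1 : contfun K :=
  contfun_restrict (f := cst 1) (fun x => @cst_continuous _ _ _ x).

Lemma contfun1E x : K x -> contfun1 x = 1.
Proof. by move=> Kx; rewrite /= /patch mem_set. Qed.

Lemma contfun1_ge0 x : 0 <= contfun1 x.
Proof. by rewrite /= /patch; case: ifP. Qed.

Lemma contfun_mulE f g x : contfun_mul f g x = f x * g x. Proof. by []. Qed.
Lemma contfun_minE f g x : contfun_min f g x = Num.min (f x) (g x).
Proof. by []. Qed.
Lemma contfunDE f g x : (f + g) x = f x + g x. Proof. by []. Qed.
Lemma contfunBE f g x : (f - g) x = f x - g x. Proof. by []. Qed.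
Lemma contfunZE (a : R) f x : (a *: f) x = a * f x. Proof. by []. Qed.
Lemma contfun0E x : (0 : contfun K) x = 0. Proof. by []. Qed.

Lemma contfun_sumE (I : Type) (r : seq I) (F : I -> contfun K) x :
  (\sum_(i <- r) F i) x = \sum_(i <- r) F i x.
Proof. by elim/big_rec2: _ => // i y1 y2 _ <-. Qed.

Lemma contfun_eq f g : f =1 g -> f = g.
Proof. by move=> fg; apply: val_inj; apply/funext. Qed.

Lemma contfun_eq_on f g : (forall x, K x -> f x = g x) -> f = g.
Proof.
move=> fg; apply: contfun_eq => x; have [/fg//|nKx] := pselect (K x).
by rewrite (contfunP f).2// (contfunP g).2.
Qed.

Lemma contfun_ge0 f : (forall x, K x -> 0 <= f x) -> forall x, 0 <= f x.
Proof.
move=> f0 x; have [/f0//|nKx] := pselect (K x).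
by rewrite (contfunP f).2.
Qed.

Hypothesis Kc : compact K.

Lemma contfun_bounded f : exists M : R, forall x, `|f x| <= M.
Proof.
have [cf f0] := contfunP f.
have [M [Mr HM]] : bounded_set (f @` K).
  by apply: compact_bounded; exact: (@continuous_compact _ _ f K).
exists (`|M| + 1) => x.
have M1 : M < `|M| + 1 by rewrite (le_lt_trans (ler_norm M))// ltrDl.
have [Kx|/f0->] := pselect (K x); last by rewrite normr0 addr_ge0.
by apply: (HM _ M1); exists x.
Qed.

Lemma le_supnorm f x : K x -> `|f x| <= supnorm f.
Proof.
move=> Kx; have [M HM] := contfun_bounded f.
have ub : has_ubound [set `|f x| | x in K] by exists M => _ [y _ <-].
by apply: ub_le_sup => //; exists x.
Qed.

End ContfunLattice.

Lemma open_pos_continuous (R : realType) (V : normedModType R) (O : set V) :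
  open O -> ~` O !=set0 -> exists g : V -> R,
    [/\ continuous g, forall x, 0 <= g x & forall x, O x <-> 0 < g x].
Proof.
move=> oO [a Oa].
have fin x : edist_inf (~` O) x \is a fin_num.
  rewrite ge0_fin_numE ?edist_inf_ge0//.
  apply: (@le_lt_trans _ _ (edist (x, a))).
    by apply: ereal_inf_lbound; exists a.
  rewrite -ge0_fin_numE ?edist_ge0//; apply/edist_finP.
  exists (`|x - a| + 1); first by rewrite ltr_wpDl.
  by rewrite -ball_normE /= ltrDl.
exists (fun x => fine (edist_inf (~` O) x)); split.
- move=> x; apply: fine_cvg; rewrite fineK//; exact: edist_inf_continuous.
- by move=> x; rewrite fine_ge0// edist_inf_ge0.
- move=> x; split=> [Ox|]; last first.
    by apply: contraPP => nOx; rewrite edist_inf0//= ltxx.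
  have [e /= e0 eO] : nbhs_ball x O by apply/nbhs_ballP; exact: open_nbhs_nbhs.
  rewrite (@lt_le_trans _ _ e)// -lee_fin fineK//.
  apply: le_ereal_inf_tmp => _ [y nOy <-]; rewrite leNgt; apply/negP.
  by move=> /edist_lt_ball /= /eO.
Qed.

Section MeasurableContfun.
Context (R : realType) (d : nat) (K : set (Rd R d)).
Hypothesis Kc : compact K.

Lemma open_measurable_Rd (O : set (Rd R d)) : open O -> measurable O.
Proof. by move=> oO; exact: sub_sigma_algebra. Qed.

Lemma compact_measurable_Rd : measurable K.
Proof.
rewrite -(setCK K); apply: measurableC; apply: open_measurable_Rd.
by rewrite openC; apply: compact_closed => //; exact: norm_hausdorff.
Qed.

Lemma contfun_measurable (f : contfun K) : measurable_fun [set: Rd R d] f.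
Proof.
have [cf f0] := contfunP f.
apply: (measurability _ (RGenOpens.measurableE R)).
move=> _ [_ [a [b ->] <-]]; rewrite setTI.
set U := [set` _]; have oU : open U by exact: interval_open.
have [V oV VK] : exists2 V, open V & V `&` K = (f @^-1` U) `&` K.
  by apply/open_subspaceP; move/continuousP: cf; exact.
have -> : f @^-1` U = (V `&` K) `|` (~` K `&` [set _ | U 0]).
  rewrite VK; apply/seteqP; split=> [x Ux|x [[]//|[nKx /= U0]]].
    have [Kx|nKx] := pselect (K x); [by left|right].
    by split=> //; rewrite /= -(f0 x nKx).
  by rewrite /preimage/= f0.
apply: measurableU; apply: measurableI.
- exact: open_measurable_Rd.
- exact: compact_measurable_Rd.
- by apply: measurableC; exact: compact_measurable_Rd.
- have [U0|nU0] := pselect (U 0).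
    by rewrite (_ : [set _ | U 0] = setT)//; apply/seteqP; split.
  by rewrite (_ : [set _ | U 0] = set0)//; apply/seteqP; split.
Qed.

End MeasurableContfun.

Section PositiveFunctional.
Context (R : realType) (d : nat) (K : set (Rd R d)) (u : {scalar contfun K}).
Hypothesis u_ge0 : forall f : contfun K, (forall x, 0 <= f x) -> 0 <= u f.
Implicit Types f g : contfun K.

Lemma functional_le f g : (forall x, K x -> f x <= g x) -> u f <= u g.
Proof.
move=> fg; rewrite -subr_ge0 -raddfB; apply: u_ge0; apply: contfun_ge0 => x Kx.
by rewrite contfunBE subr_ge0; exact: fg.
Qed.

Lemma functionalZ a f : u (a *: f) = a * u f.
Proof. by rewrite linearZ. Qed.

(* [c] bounds the mass of [A] from above, as witnessed by an increasing sequence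
   of continuous functions that eventually dominates the indicator of [A]. *)
Definition cover_cost (A : set (Rd R d)) (c : R) : Prop :=
  exists F : nat -> contfun K,
    [/\ forall n x, 0 <= F n x,
        forall m n, (m <= n)%N -> forall x, F m x <= F n x,
        forall n, u (F n) <= c &
        forall x, A x -> K x -> exists n, 1 <= F n x].

Definition outer_mass (A : set (Rd R d)) : \bar R :=
  ereal_inf [set c%:E | c in cover_cost A].

Lemma cover_cost_ge0 A c : cover_cost A c -> 0 <= c.
Proof. by case=> F [F0 _ Fc _]; rewrite (le_trans _ (Fc 0%N))// u_ge0. Qed.

Lemma cover_cost_single A g : (forall x, 0 <= g x) ->
  (forall x, A x -> K x -> 1 <= g x) -> cover_cost A (u g).
Proof.
by move=> g0 g1; exists (fun=> g); split=> // x Ax Kx; exists 0%N; exact: g1.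
Qed.

Lemma outer_mass_le A c : cover_cost A c -> (outer_mass A <= c%:E)%E.
Proof. by move=> Ac; apply: ereal_inf_lbound; exists c. Qed.

Lemma outer_mass_le_functional A g : (forall x, 0 <= g x) ->
  (forall x, A x -> K x -> 1 <= g x) -> (outer_mass A <= (u g)%:E)%E.
Proof. by move=> g0 g1; apply/outer_mass_le/cover_cost_single. Qed.

Lemma outer_mass_ge0 A : (0 <= outer_mass A)%E.
Proof.
apply: le_ereal_inf_tmp => _ [c Ac <-]; rewrite lee_fin.
exact: cover_cost_ge0 Ac.
Qed.

Lemma outer_mass_fin A : outer_mass A \is a fin_num.
Proof.
rewrite ge0_fin_numE ?outer_mass_ge0//.
rewrite (@le_lt_trans _ _ (u (contfun1 K))%:E) ?ltey//.
apply: outer_mass_le_functional; first exact: contfun1_ge0.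
by move=> x _ /contfun1E ->.
Qed.

Lemma outer_mass_off A : A `&` K `<=` set0 -> outer_mass A = 0%E.
Proof.
move=> AK; apply/eqP; rewrite eq_le outer_mass_ge0 andbT.
have := @outer_mass_le_functional A 0; rewrite raddf0; apply=> // x Ax Kx.
by have := AK x (conj Ax Kx).
Qed.

Lemma outer_mass0 : outer_mass set0 = 0%E.
Proof. by apply: outer_mass_off => x []. Qed.

Lemma le_outer_mass : {homo outer_mass : A B / A `<=` B >-> (A <= B)%E}.
Proof.
move=> A B AB; apply: ereal_inf_le_tmp => _ [c [F [F0 Fle Fc F1]] <-].
by exists c => //; exists F; split=> // x Ax; apply: F1; exact: AB.
Qed.

Lemma outer_mass_adherent A (e : R) : 0 < e ->
  exists2 c, cover_cost A c & (c%:E < outer_mass A + e%:E)%E.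
Proof.
move=> e0.
have [_ [c Ac <-] ce] := lb_ereal_inf_adherent e0 (outer_mass_fin A).
by exists c.
Qed.

Lemma outer_mass_sigma_subadditive : sigma_subadditive outer_mass.
Proof.
move=> A; apply/lee_addgt0Pr => e e0.
have /choice[c /all_and2[Ac ce]] n : exists c, cover_cost (A n) c /\
    (c%:E <= outer_mass (A n) + (e / (2 ^ n.+1)%:R)%:E)%E.
  have [|c] := @outer_mass_adherent (A n) (e / (2 ^ n.+1)%:R).
    by rewrite divr_gt0// ltr0n expn_gt0.
  by exists c; split=> //; exact: ltW.
apply: (@le_trans _ _ (\sum_(n <oo) (c n)%:E)%E); last first.
  apply: le_trans (epsilon_trick xpredT _ (ltW e0)) => //; last first.
    by move=> n; exact: outer_mass_ge0.
  by apply: lee_nneseries => // n _ _; rewrite lee_fin (cover_cost_ge0 (Ac n)).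
have [F HF] := choice Ac.
have F0 i n x : 0 <= F i n x by have [] := HF i.
have Fle i m n : (m <= n)%N -> forall x, F i m x <= F i n x.
  by have [_ + _ _] := HF i; exact.
have c0 n : 0 <= c n by exact: cover_cost_ge0 (Ac n).
have Slim := @is_cvg_nneseries R (fun n => (c n)%:E) xpredT 0%N
  (fun n _ _ => c0 n).
have [->|] := eqVneq (\sum_(n <oo) (c n)%:E)%E +oo%E; first by rewrite leey.
rewrite -ltey => Sfin.
have S0 : (0 <= \sum_(n <oo) (c n)%:E)%E.
  by apply: nneseries_ge0 => n _ _; rewrite lee_fin.
rewrite -(@fineK _ (\sum_(n <oo) (c n)%:E)%E) ?ge0_fin_numE//.
apply: outer_mass_le; exists (fun n => \sum_(i < n) F i n); split.
- by move=> n x; rewrite contfun_sumE sumr_ge0.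
- move=> m n mn x; rewrite !contfun_sumE.
  rewrite (big_ord_widen n (fun i => F i m x))//.
  rewrite big_mkcond/= ler_sum// => i _; case: ifP => _ //=; exact: Fle.
- move=> n; rewrite -lee_fin fineK ?ge0_fin_numE//.
  apply: (@le_trans _ _ (\sum_(0 <= i < n) (c i)%:E)%E).
    rewrite big_mkord sumEFin lee_fin raddf_sum/=.
    by apply: ler_sum => i _; have [_ _ + _] := HF i; exact.
  by apply: nneseries_lim_ge => i _ _; rewrite lee_fin.
- move=> x [i _ Aix] Kx; have [_ _ _ /(_ x Aix Kx)[n Fn1]] := HF i.
  exists (maxn n i.+1); rewrite contfun_sumE.
  rewrite (bigD1 (Ordinal (leq_maxr n i.+1)))//=.
  rewrite (le_trans Fn1)// (le_trans (Fle i _ _ (leq_maxl n i.+1) x))//.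
  by rewrite lerDl sumr_ge0.
Qed.

HB.instance Definition _ := isOuterMeasure.Build R (Rd R d) outer_mass
  outer_mass0 outer_mass_ge0 le_outer_mass outer_mass_sigma_subadditive.

(* [min 1 (n * f)] increases to the indicator of [f > 0], so multiplying a
   cover by it and by its complement splits the cost. *)
Lemma caratheodory_pos f : (forall x, 0 <= f x) ->
  outer_mass.-caratheodory [set x | 0 < f x].
Proof.
move=> f0; apply: le_caratheodory_measurable => X.
apply/lee_addgt0Pr => e e0.
have [c [F [F0 Fle Fc F1]] ce] := @outer_mass_adherent X (e / 2)
  (divr_gt0 e0 (ltr0n _ 2)).
pose g n := contfun_min (contfun1 K) (n%:R *: f).
have gE n x : K x -> g n x = Num.min 1 (n%:R * f x).
  by move=> Kx; rewrite /g contfun_minE contfun1E.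
have g0 n x : 0 <= g n x.
  by apply: contfun_ge0 => y Ky; rewrite gE// le_min ler01 mulr_ge0.
have g1 n x : g n x <= 1.
  have [Kx|nKx] := pselect (K x); last by rewrite (contfunP _).2.
  by rewrite gE// ge_min lexx.
have gle m n x : (m <= n)%N -> g m x <= g n x.
  move=> mn; have [Kx|nKx] := pselect (K x); last by rewrite !(contfunP _).2.
  by rewrite !gE// le_min !ge_min lexx/= ler_wpM2r ?ler_nat ?orbT.
pose G n := contfun_mul (F n) (g n).
have GE n x : G n x = F n x * g n x by [].
have Gle m n x : (m <= n)%N -> G m x <= G n x.
  by move=> mn; apply: ler_pM => //; [exact: Fle|exact: gle].
have GF n x : G n x <= F n x by rewrite ler_piMr.
have GS : has_sup [set u (G n) | n in setT].
  split; first by exists (u (G 0%N)), 0%N.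
  exists c => _ [n _ <-]; apply: le_trans (Fc n); apply: functional_le => x _.
  exact: GF.
pose a := sup [set u (G n) | n in setT].
have GX : cover_cost (X `&` [set x | 0 < f x]) a.
  exists G; split.
  - by move=> n x; rewrite mulr_ge0.
  - by move=> m n mn x; exact: Gle.
  - by move=> n; apply: ub_le_sup; [exact: GS.2|exists n].
  - move=> x [Xx fx] Kx; have [n Fn] := F1 x Xx Kx.
    have [m fm] : exists m : nat, 1 <= m%:R * f x.
      exists (Num.Def.archi_bound (f x)^-1).
      rewrite -ler_pdivrMr// div1r ltW// archi_boundP// invr_ge0 ltW//.
    exists (maxn n m); rewrite GE -[leLHS]mulr1 ler_pM//.
      by rewrite (le_trans Fn)// Fle// leq_maxl.
    rewrite (le_trans _ (gle m _ x (leq_maxr _ _)))// gE//.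
    by rewrite le_min lexx.
have [_ [N _ <-] aN] := sup_adherent (divr_gt0 e0 (ltr0n R 2)) GS.
have HX : cover_cost (X `&` ~` [set x | 0 < f x]) (c - a + e / 2).
  have HE n x : (F n - contfun_mul (F n) (g N)) x = F n x * (1 - g N x).
    by rewrite contfunBE contfun_mulE mulrBr mulr1.
  exists (fun n => F n - contfun_mul (F n) (g N)); split.
  - by move=> n x; rewrite HE mulr_ge0// subr_ge0.
  - by move=> m n mn x; rewrite !HE ler_wpM2r ?subr_ge0//; exact: Fle.
  - move=> n; apply: (@le_trans _ _
        (u (F (maxn n N) - contfun_mul (F (maxn n N)) (g N)))).
      apply: functional_le => x _; rewrite !HE ler_wpM2r ?subr_ge0//.
      by apply: Fle; exact: leq_maxl.
    rewrite [u _]raddfB.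
    have h1 : u (G N) <= u (contfun_mul (F (maxn n N)) (g N)).
      apply: functional_le => x _; apply: ler_wpM2r; first exact: g0.
      by apply: Fle; exact: leq_maxr.
    have := Fc (maxn n N); move: aN h1; rewrite -/a; lra.
  - move=> x [Xx /negP nfx] Kx; have [n Fn] := F1 x Xx Kx.
    exists n; rewrite HE gE//.
    have -> : f x = 0 by apply/eqP; rewrite eq_le f0 andbT leNgt.
    by rewrite mulr0 (min_idPr _)// subr0 mulr1.
apply: le_trans (leeD (outer_mass_le GX) (outer_mass_le HX)) _.
rewrite -EFinD (_ : a + (c - a + e / 2) = c + e / 2); last by ring.
rewrite EFinD (le_trans (leeD2r _ (ltW ce)))// -addeA -EFinD -splitr//.
Qed.

Lemma off_caratheodory A : A `&` K `<=` set0 -> outer_mass.-caratheodory A.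
Proof.
move=> AK; apply: le_caratheodory_measurable => X.
rewrite [X in (X + _)%E](_ : _ = 0%E) ?add0e.
  by apply: le_outer_mass => x [].
by apply: outer_mass_off => x [[_ Ax] Kx]; exact: AK.
Qed.

Lemma open_caratheodory O : open O -> outer_mass.-caratheodory O.
Proof.
move=> oO; have [nO0|/set0P nO] := eqVneq (~` O) set0.
  rewrite -(setCK O) nO0; apply: caratheodory_measurable_setC.
  exact: caratheodory_measurable_set0.
have [g [cg g0 gO]] := open_pos_continuous oO nO.
rewrite -(setUIDK O K); apply: caratheodory_measurable_setU; last first.
  by apply: off_caratheodory => x [[]].
rewrite (_ : O `&` K = [set x | 0 < contfun_restrict K cg x]).
  by apply: caratheodory_pos => x /=; rewrite /patch; case: ifP.
apply/seteqP; split=> x /=; rewrite /patch.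
  by move=> [xO Kx]; rewrite mem_set//; exact/gO.
by case: ifPn; rewrite ?ltxx// inE => Kx /gO.
Qed.

Lemma borel_caratheodory (A : set (Rd R d)) :
  measurable A -> outer_mass.-caratheodory A.
Proof.
move: A; apply: smallest_sub => [|O]; last exact: open_caratheodory.
split.
- exact: caratheodory_measurable_set0.
- by move=> A mA; rewrite setTD; exact: caratheodory_measurable_setC.
- by move=> F mF; exact: caratheodory_measurable_bigcup.
Qed.

Definition riesz_measure (A : set (Rd R d)) : \bar R := outer_mass A.

Lemma riesz_measure_sigma_additive : semi_sigma_additive riesz_measure.
Proof.
move=> F mF tF mUF.
by apply: (@caratheodory_measure_sigma_additive R (Rd R d) outer_mass F) => //;
  [move=> n; exact: borel_caratheodory|exact: borel_caratheodory].
Qed.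

HB.instance Definition _ := isMeasure.Build _ (Rd R d) R riesz_measure
  outer_mass0 outer_mass_ge0 riesz_measure_sigma_additive.

Hypothesis Kc : compact K.

Lemma functional1_le_outer_mass : ((u (contfun1 K))%:E <= outer_mass K)%E.
Proof.
apply: le_ereal_inf_tmp => _ [c [F [F0 Fle Fc F1]] <-]; rewrite lee_fin.
apply/ler_addgt0Pr => e e0.
have u1 : 0 <= u (contfun1 K) by apply: u_ge0; exact: contfun1_ge0.
pose t := e / (u (contfun1 K) + 1).
have t0 : 0 < t by rewrite divr_gt0// ltr_wpDl.
have : \forall n \near \oo, forall x, K x -> 1 - t <= F n x.
  have /compact_near_coveringP/near_covering_withinP := Kc.
  move=> /(_ nat \oo (fun n x => 1 - t <= F n x)); apply => x Kx.
  have [m Fm] := F1 x Kx Kx.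
  have cFm : {within K, continuous (F m)} := (contfunP (F m)).1.
  have /(cvgr_ge (F m x)) : F m @ within K (nbhs x) --> F m x.
    by move/subspace_continuousP : cFm; exact.
  move=> /(_ (1 - t)); rewrite (lt_le_trans _ Fm) ?gtrBl// => /(_ isT) h.
  exists ([set y | K y -> 1 - t <= F m y], [set n | (m <= n)%N]) => /=.
    by split; [exact: h|exists m].
  by move=> [y n] /= [yK mn] Ky; rewrite (le_trans (yK Ky))// Fle.
move=> [n _ /(_ n (leqnn n)) Fn].
have : u ((1 - t) *: contfun1 K) <= c.
  apply: le_trans (Fc n); apply: functional_le => x Kx.
  by rewrite contfunZE contfun1E// mulr1 Fn.
rewrite functionalZ mulrBl mul1r lerBlDr => /le_trans; apply.
rewrite lerD2l /t mulrAC ler_pdivrMr ?ltr_wpDl//.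
by rewrite mulrDr mulr1 lerDl ltW.
Qed.

Let mu : {measure set (Rd R d) -> \bar R} := riesz_measure.
Let mEFin f : measurable_fun [set: Rd R d] (fun x => (f x)%:E).
Proof. apply/measurable_EFinP; exact: contfun_measurable. Qed.

Lemma riesz_measureT : mu [set: Rd R d] = (u (contfun1 K))%:E.
Proof.
apply/eqP; rewrite eq_le; apply/andP; split.
  apply: outer_mass_le_functional; first exact: contfun1_ge0.
  by move=> x _ /contfun1E ->.
by rewrite (le_trans functional1_le_outer_mass)// le_outer_mass.
Qed.

Let cut (e : R) f := contfun_min f (e *: contfun1 K).

Let cutE e f x : K x -> cut e f x = Num.min (f x) e.
Proof. by move=> Kx; rewrite /cut contfun_minE contfunZE contfun1E// mulr1. Qed.

Let cut_le e f x : cut e f x <= f x.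
Proof. by rewrite /cut contfun_minE ge_min lexx. Qed.

Let cut_ge0 e f : 0 < e -> (forall x, 0 <= f x) -> forall x, 0 <= cut e f x.
Proof.
by move=> e0 f0; apply: contfun_ge0 => x Kx; rewrite cutE// le_min f0 ltW.
Qed.

Let integral_cut e f : 0 < e -> (forall x, 0 <= f x) ->
  (\int[mu]_x (f x)%:E =
   \int[mu]_x (cut e f x)%:E + \int[mu]_x ((f - cut e f) x)%:E)%E.
Proof.
move=> e0 f0; rewrite -ge0_integralD//.
- by apply: eq_integral => x _; rewrite -EFinD contfunBE subrKC.
- by move=> x _; rewrite lee_fin cut_ge0.
- by move=> x _; rewrite lee_fin contfunBE subr_ge0 cut_le.
Qed.

(* Each layer of [f] of height [e] has integral at most [e * mu (f > e)], hence
   at most [u (min f e)], the contribution of the layer just below. *)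
Lemma integral_above_le (n : nat) (e : R) f : 0 < e ->
  (forall x, 0 <= f x) -> (forall x, K x -> f x <= n%:R * e) ->
  (\int[mu]_x ((f - cut e f) x)%:E <= (u f)%:E)%E.
Proof.
move=> e0; elim: n f => [|n IH] f f0 fn.
  rewrite (_ : f = 0); last first.
    apply: contfun_eq_on => x Kx; apply/eqP; rewrite eq_le f0 andbT.
    by rewrite (le_trans (fn x Kx))// mul0r.
  rewrite integral0_eq ?raddf0// => x _; congr EFin.
  rewrite contfunBE /cut contfun_minE contfunZE contfun0E (min_idPl _) ?subr0//.
  by rewrite mulr_ge0 ?contfun1_ge0// ltW.
set g := f - cut e f.
have g0 x : 0 <= g x by rewrite contfunBE subr_ge0 cut_le.
have gn x : K x -> g x <= n%:R * e.
  move=> Kx; rewrite contfunBE cutE//; have := fn x Kx.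
  have ne0 : 0 <= n%:R * e by rewrite mulr_ge0// ltW.
  rewrite -natr1 mulrDl mul1r => fx; rewrite /Num.min; case: ifP => _.
    by rewrite subrr.
  by rewrite lerBlDr.
rewrite (integral_cut e0 g0).
have -> : u f = u (cut e f) + u g by rewrite -raddfD subrKC.
rewrite EFinD; apply: leeD; last exact: IH.
pose A := [set x | e < f x].
have mA : measurable A.
  rewrite -[A]setTI; have := @contfun_measurable R d K Kc f measurableT
    `]e, +oo[%classic.
  rewrite (_ : f @^-1` `]e, +oo[%classic = A); last first.
    by apply/seteqP; split=> x /=; rewrite in_itv/= andbT.
  by apply; exact: measurable_itv.
have gA x : cut e g x <= e * \1_A x.
  have [Kx|nKx] := pselect (K x); last first.
    by rewrite (contfunP (cut e g)).2// mulr_ge0// ltW.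
  rewrite cutE// indicE; have [xA|] := boolP (x \in A).
    by rewrite mulr1 ge_min lexx orbT.
  rewrite notin_setE => /negP; rewrite -leNgt => fe.
  have gx : g x = 0 by rewrite contfunBE cutE// (min_idPl fe) subrr.
  by rewrite mulr0 ge_min gx lexx.
apply: (@le_trans _ _ (\int[mu]_x (e%:E * (\1_A x)%:E))%E).
  apply: ge0_le_integral => //.
  - by move=> x _; rewrite lee_fin cut_ge0.
  - by apply: measurable_funeM; exact/measurable_EFinP.
  - by move=> x _; rewrite -EFinM lee_fin.
rewrite ge0_integralZl_EFin ?(ltW e0)//; last exact/measurable_EFinP.
rewrite integral_indic// setIT.
have : (mu A <= (u (e^-1 *: cut e f))%:E)%E.
  apply: outer_mass_le_functional => [x|x fx Kx].
    by rewrite contfunZE mulr_ge0 ?invr_ge0 ?(ltW e0)// cut_ge0.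
  by rewrite contfunZE cutE// (min_idPr (ltW _))// mulVf ?gt_eqF.
have e0E : (0 <= e%:E)%E by rewrite lee_fin ltW.
rewrite functionalZ => /(lee_wpmul2l e0E) /le_trans; apply.
by rewrite -EFinM mulrA mulfV ?gt_eqF// mul1r.
Qed.

Lemma integral_le_functional f : (forall x, 0 <= f x) ->
  (\int[mu]_x (f x)%:E <= (u f)%:E)%E.
Proof.
move=> f0; apply/lee_addgt0Pr => t t0.
have u1 : 0 <= u (contfun1 K) by apply: u_ge0; exact: contfun1_ge0.
pose e := t / (u (contfun1 K) + 1).
have e0 : 0 < e by rewrite divr_gt0// ltr_wpDl.
have [M fM] := contfun_bounded Kc f.
have [n nM] : exists n : nat, M <= n%:R * e.
  exists (Num.bound (`|M| / e)); rewrite -ler_pdivrMr//.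
  have Me0 : 0 <= `|M| / e by rewrite divr_ge0// ltW.
  rewrite (le_trans _ (ltW (archi_boundP Me0)))//.
  by rewrite ler_pM2r ?invr_gt0// ler_norm.
rewrite (integral_cut e0 f0) addeC; apply: leeD.
  apply: (@integral_above_le n) => // x _.
  by rewrite (le_trans _ nM)// (le_trans _ (fM x))// ler_norm.
apply: (@le_trans _ _ (\int[mu]_x (cst e%:E x))%E).
  apply: ge0_le_integral => //.
  - by move=> x _; rewrite lee_fin cut_ge0.
  - move=> x _; rewrite lee_fin.
    have [Kx|nKx] := pselect (K x); first by rewrite cutE// ge_min lexx orbT.
    by rewrite (contfunP (cut e f)).2// ltW.
rewrite integral_cst// riesz_measureT -EFinM lee_fin /e mulrAC.
by rewrite ler_pdivrMr ?ltr_wpDl// mulrDr mulr1 lerDl ltW.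
Qed.

Lemma integrable_contfun f : mu.-integrable [set: Rd R d] (EFin \o f).
Proof.
apply: measurable_bounded_integrable => //.
- by rewrite riesz_measureT ltey.
- exact: contfun_measurable.
- have [M fM] := contfun_bounded Kc f; exists M; split; first exact: num_real.
  by move=> N MN x _; apply: le_trans (fM x) (ltW MN).
Qed.

Lemma Rintegral_le_functional f : (forall x, 0 <= f x) -> \int[mu]_x f x <= u f.
Proof.
move=> f0; rewrite -lee_fin /Rintegral fineK ?integral_le_functional//.
exact: integrable_fin_num (integrable_contfun f).
Qed.

Lemma riesz_measure_negligible : mu.-negligible (~` K).
Proof.
exists (~` K); split=> //.
  by apply: measurableC; exact: compact_measurable_Rd.
by apply: outer_mass_off => x [].
Qed.

Lemma Rintegral_contfun1 : \int[mu]_x contfun1 K x = u (contfun1 K).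
Proof.
transitivity (\int[mu]_(x in K) cst 1 x).
  by rewrite [RHS]Rintegral_mkcond; exact: eq_Rintegral.
have mK : measurable K by exact: compact_measurable_Rd.
rewrite Rintegral_cst// mul1r -[RHS]/(fine (u (contfun1 K))%:E) -riesz_measureT.
congr fine; apply/eqP; rewrite eq_le le_outer_mass//=.
by rewrite riesz_measureT functional1_le_outer_mass.
Qed.

Lemma Rintegral_functional f : \int[mu]_x f x = u f.
Proof.
have [M fM] := contfun_bounded Kc f.
have intD (a b : R) (g h : contfun K) :
    \int[mu]_x (a *: g + b *: h) x =
    a * \int[mu]_x g x + b * \int[mu]_x h x.
  rewrite (@RintegralD _ _ _ mu setT
    (a *: g : contfun K) (b *: h : contfun K))//.
  - rewrite (@RintegralZl _ _ _ mu setT g)// ?(@RintegralZl _ _ _ mu setT h)//.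
    + exact: integrable_contfun.
    + exact: integrable_contfun.
  - exact: integrable_contfun.
  - exact: integrable_contfun.
have H (b : R) : `|b| <= 1 ->
    M * u (contfun1 K) + b * \int[mu]_x f x <= M * u (contfun1 K) + b * u f.
  move=> b1; rewrite -{1}Rintegral_contfun1 -intD -!functionalZ -raddfD.
  apply: Rintegral_le_functional; apply: contfun_ge0 => x Kx.
  rewrite contfunDE !contfunZE contfun1E// mulr1 -lerBlDr sub0r.
  rewrite -mulNr (le_trans (ler_norm _))// normrM normrN.
  rewrite (le_trans _ (fM x))// ler_piMl//.
apply/eqP; rewrite eq_le.
have := H 1; rewrite normr1 lexx lerD2l !mul1r => ->//=.
by have := H (-1); rewrite normrN normr1 lexx lerD2l !mulN1r lerN2; exact.
Qed.

Lemma riesz_markov : exists m : {measure set (Rd R d) -> \bar R},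
  [/\ (m [set: Rd R d] < +oo)%E, m.-negligible (~` K) &
      forall f, u f = \int[m]_x f x].
Proof.
exists mu; split; first by rewrite riesz_measureT ltey.
  exact: riesz_measure_negligible.
by move=> f; rewrite Rintegral_functional.
Qed.

End PositiveFunctional.

Section Radon.
Context (R : realType) (d : nat) (K : set (Rd R d)).
Hypothesis Kc : compact K.

Lemma radon_nonnegP (u : radon K) :
  radon_nonneg u <-> forall f : contfun K, (forall x, 0 <= f x) -> 0 <= u f.
Proof.
split=> [[m [_ _ um]] f f0|u0]; first by rewrite um; exact: Rintegral_ge0.
exact: riesz_markov.
Qed.

Lemma functional_bound (u : {scalar contfun K}) :
  (forall f : contfun K, (forall x, 0 <= f x) -> 0 <= u f) ->
  forall (f : contfun K) (M : R), (forall x, K x -> `|f x| <= M) ->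
    `|u f| <= u (contfun1 K) * M.
Proof.
move=> u0 f M fM; rewrite mulrC -(functionalZ u M) ler_norml; apply/andP; split.
  rewrite -lerN2 opprK -raddfN; apply: functional_le => // x Kx.
  rewrite contfunZE contfun1E// mulr1 (le_trans _ (fM x Kx))//.
  by rewrite -normrN; exact: (ler_norm (- f x)).
apply: functional_le => // x Kx.
by rewrite contfunZE contfun1E// mulr1 (le_trans _ (fM x Kx))// ler_norm.
Qed.

Lemma ultra_cvg_bounded (G : set_system nat) (a : nat -> R) (c : R) :
  UltraFilter G -> (forall n, `|a n| <= c) ->
  exists l : R, a n @[n --> G] --> l.
Proof.
move=> GU ac.
have GP : ProperFilter G by exact: ultra_proper.
have /(_ (a @ G)) := @segment_compact R (- c) c.
case=> [|l [_ cl]].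
  by apply: (@filterE _ G) => n; rewrite /= in_itv /= -ler_norml; exact: ac.
exists l => U Ul; have [//|nGU] := in_ultra_setVsetC (a @^-1` U) GU.
by have [x [/= nUx Ux]] := cl (~` U) U nGU Ul.
Qed.

Lemma radon_seq_compact (u_ : nat -> radon K) (M : R) :
  (forall n, radon_nonneg (u_ n)) -> (forall n, u_ n (contfun1 K) <= M) ->
  exists2 u : radon K, radon_nonneg u &
    forall (f : contfun K) (l : R), u_ n f @[n --> \oo] --> l -> u f = l.
Proof.
move=> u_0 uM; have u_ge0 n := (radon_nonnegP (u_ n)).1 (u_0 n).
have [G [GU ooG]] := ultraFilterLemma (eventually_filter : ProperFilter \oo).
have GP : ProperFilter G by exact: ultra_proper.
have /choice[L HL] (f : contfun K) : exists l : R, u_ n f @[n --> G] --> l.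
  have [N fN] := contfun_bounded Kc f.
  apply: (@ultra_cvg_bounded _ _ (M * `|N|)) => // n.
  have := @functional_bound (u_ n) (u_ge0 n) f `|N|
    (fun x _ => le_trans (fN x) (ler_norm N)).
  by move=> /le_trans; apply; rewrite ler_wpM2r.
have Lu f l : u_ n f @[n --> G] --> l -> L f = l.
  by move=> ul; apply: (cvg_unique _ (HL f) ul).
have Llin : linear_for *%R L.
  move=> a f g; apply: Lu; under eq_fun do rewrite linearP.
  by apply: cvgD; [apply: cvgM; [exact: cvg_cst|exact: HL]|exact: HL].
have L0 (f : contfun K) : (forall x, 0 <= f x) -> 0 <= L f.
  move=> f0; rewrite leNgt; apply/negP => Lf0.
  have [n un] := filter_ex (cvgr_lt (L f) (HL f) 0 Lf0).
  by have := u_ge0 n f f0; rewrite leNgt un.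
pose LL : {scalar contfun K} := HB.pack L (GRing.isLinear.Build _ _ _ _ L Llin).
have LLb : exists c : R, forall f, `|LL f| <= c * supnorm f.
  exists (LL (contfun1 K)) => f; apply: functional_bound; first exact: L0.
  by move=> x Kx; exact: le_supnorm.
exists (Radon LLb); first exact/radon_nonnegP.
by move=> f l ul; apply: Lu; apply: cvg_trans ul; apply: cvg_app.
Qed.

End Radon.

(** * Square-integrable functions *)

Section L2.
Context (disp : measure_display) (T : measurableType disp) (R : realType).
Variable mu : {measure set T -> \bar R}.
Local Notation L2 := (Lfun mu 2%:E).
Implicit Types f g h : T -> R.

Lemma L2_comb (a b : R) f g : f \in L2 -> g \in L2 -> a *: f + b *: g \in L2.
Proof.
have p1 : (1 <= 2%:E :> \bar R)%E by rewrite lee_fin ler1n.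
have [_ Lc] := Lfun_submod_closed mu p1.
move=> f2 g2; apply: (Lc a) => //; rewrite -[b *: g]addr0; apply: Lc => //.
exact: (Lfun_submod_closed mu p1).1.
Qed.

Lemma L2B f g : f \in L2 -> g \in L2 -> f - g \in L2.
Proof.
by move=> f2 g2; rewrite -[f]scale1r -scaleN1r; exact: L2_comb.
Qed.

Definition ip f g : R := \int[mu]_x (f x * g x).

Lemma L2_measurable f : f \in L2 -> measurable_fun [set: T] f.
Proof. by rewrite inE => /andP[/[!inE]]. Qed.

Lemma integrable_ip f g : f \in L2 -> g \in L2 ->
  mu.-integrable [set: T] (fun x => (f x * g x)%:E).
Proof. by move=> f2 g2; have /Lfun1_integrable := Lfun2_mul_Lfun1 f2 g2. Qed.

Lemma ipC f g : ip f g = ip g f.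
Proof. by apply: eq_Rintegral => x _; rewrite mulrC. Qed.

Lemma ip_comb (a b : R) f g h : f \in L2 -> g \in L2 -> h \in L2 ->
  ip h (a *: f + b *: g) = a * ip h f + b * ip h g.
Proof.
move=> f2 g2 h2; rewrite /ip.
rewrite -RintegralZl//; last exact: integrable_ip.
rewrite -RintegralZl//; last exact: integrable_ip.
rewrite -RintegralD//.
- apply: eq_Rintegral => x _.
  by rewrite -[LHS]/(h x * (a * f x + b * g x)); ring.
- exact: (integrableZl measurableT a (integrable_ip h2 f2)).
- exact: (integrableZl measurableT b (integrable_ip h2 g2)).
Qed.

Lemma ipB f g h : f \in L2 -> g \in L2 -> h \in L2 ->
  ip h (f - g) = ip h f - ip h g.
Proof.
move=> f2 g2 h2; have := ip_comb 1 (-1) f2 g2 h2.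
by rewrite scale1r scaleN1r mul1r mulN1r.
Qed.

Lemma ip_ge0 f : 0 <= ip f f.
Proof. by apply: Rintegral_ge0 => x _; rewrite -expr2 sqr_ge0. Qed.

Lemma ip_comb2 (a b : R) f g : f \in L2 -> g \in L2 ->
  ip (a *: f + b *: g) (a *: f + b *: g) =
  a ^+ 2 * ip f f + 2 * a * b * ip f g + b ^+ 2 * ip g g.
Proof.
move=> f2 g2; have fg2 := L2_comb a b f2 g2.
rewrite ip_comb// ![ip (_ + _) _]ipC !ip_comb// (ipC g f); ring.
Qed.

Lemma ip_Lnorm f : f \in L2 ->
  fine ('N[mu]_(2%:E)[EFin \o f])%E ^+ 2 = ip f f.
Proof.
move=> f2; rewrite -powR_mulrn ?fine_ge0 ?Lnorm_ge0//.
rewrite -fine_poweR poweR_Lnorm//; congr fine; apply: eq_integral => x _ /=.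
by rewrite powR_mulrn// real_normK// num_real.
Qed.

Lemma ip_cauchy_schwarz f g : f \in L2 -> g \in L2 ->
  ip f g ^+ 2 <= ip f f * ip g g.
Proof.
move=> f2 g2; have [gg0|gg0] := eqVneq (ip g g) 0.
  suff -> : ip f g = 0 by rewrite expr0n mulr_ge0 ?ip_ge0.
  apply/eqP; apply: contraT => fg0.
  have := ip_ge0 (1 *: f + (- (ip f f + 1) / (2 * ip f g)) *: g).
  rewrite ip_comb2// gg0 mulr0 addr0 expr1n mul1r mulr1.
  rewrite (_ : 2 * _ * ip f g = - (ip f f + 1)); last by field.
  by rewrite opprD addrA subrr add0r oppr_ge0 ler10.
have := ip_ge0 (ip g g *: f + (- ip f g) *: g).
rewrite ip_comb2//.
rewrite (_ : _ + _ = ip g g * (ip f f * ip g g - ip f g ^+ 2)); last by ring.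
by rewrite pmulr_rge0 ?lt_def ?gg0 ?ip_ge0// subr_ge0.
Qed.

Lemma ip_cvg0 h (f_ : nat -> T -> R) : h \in L2 -> (forall n, f_ n \in L2) ->
  ip (f_ n) (f_ n) @[n --> \oo] --> 0 -> ip h (f_ n) @[n --> \oo] --> 0.
Proof.
move=> h2 f2 fn0; apply/cvgrPdist_lt => e e0.
have /cvgrPdist_lt/(_ (e ^+ 2 / (ip h h + 1))) := fn0.
rewrite divr_gt0 ?exprn_gt0 ?ltr_wpDl ?ip_ge0// => /(_ isT).
apply: filterS => n; rewrite !sub0r !normrN (ger0_norm (ip_ge0 _)) => fn.
rewrite -(@ltr_pXn2r _ 2)// ?nnegrE ?(ltW e0)// real_normK ?num_real//.
apply: le_lt_trans (ip_cauchy_schwarz h2 (f2 n)) _.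
move: fn; rewrite ltr_pdivlMr ?ltr_wpDl ?ip_ge0//; apply: le_lt_trans.
by rewrite mulrC ler_wpM2l ?ip_ge0// lerDl.
Qed.

Lemma ip_integral f g : f \in L2 -> g \in L2 ->
  (\int[mu]_x (f x * g x)%:E)%E = (ip f g)%:E.
Proof.
move=> f2 g2; rewrite /ip /Rintegral fineK//.
exact: (integrable_fin_num measurableT (integrable_ip f2 g2)).
Qed.

Lemma L2P f : measurable_fun [set: T] f ->
  (\int[mu]_x (f x * f x)%:E < +oo)%E -> f \in L2.
Proof.
move=> mf ff; rewrite inE; apply/andP; split; rewrite inE//=.
rewrite /finite_norm unlock poweR_lty//; apply: le_lt_trans ff.
rewrite le_eqVlt; apply/orP; left; apply/eqP; apply: eq_integral => x _ /=.
by rewrite powR_mulrn// real_normK ?num_real// expr2.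
Qed.

Lemma cvg_of_summable_steps (a : R^nat) (C : R) :
  (forall k, 4 ^+ k * (a k.+1 - a k) ^+ 2 <= C) -> cvgn a.
Proof.
move=> aC; have C0 : 0 <= C.
  by apply: le_trans (aC 0%N); rewrite expr0 mul1r sqr_ge0.
suff: cvgn (series (telescope a)).
  rewrite telescopeK => /(is_cvgD (is_cvg_cst (a 0%N))).
  by rewrite (_ : _ + _ = a)//; apply/funext => n; rewrite !fctE subrKC.
apply: normed_cvg.
apply: (@series_le_cvg _ _ (geometric (C + 1) 2^-1)).
- by move=> n /=.
- by move=> n; rewrite /geometric/= mulr_ge0 ?addr_ge0// exprn_ge0// invr_ge0.
- move=> k; rewrite /telescope /geometric /=.
  rewrite -(@ler_pXn2r _ 2)// ?nnegrE; last first.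
    by rewrite mulr_ge0 ?addr_ge0// exprn_ge0// invr_ge0.
  rewrite real_normK ?num_real// exprMn -exprM mulnC exprM.
  have -> : 2^-1 ^+ 2 = 4^-1 :> R by rewrite exprVn -natrX.
  rewrite exprVn -ler_pdivrMr ?invr_gt0 ?exprn_gt0// invrK mulrC.
  apply: le_trans (aC k) _; rewrite sqrrD1; nra.
- apply: is_cvg_geometric_series.
  by rewrite ger0_norm ?invr_ge0// invf_lt1// ltr1n.
Qed.

(* At this rate [sum_k 4^k |g_(k+1) - g_k|^2] is integrable, so [g] converges
   almost everywhere, and Fatou's lemma turns the pointwise limit into a limit
   in L^2. *)
Lemma L2_complete_fast (g : nat -> T -> R) : (forall n, g n \in L2) ->
  (forall m n, (m <= n)%N ->
     ip (g n - g m) (g n - g m) <= (4 ^+ m * 2 ^+ m.+1)^-1) ->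
  exists2 f, f \in L2 & forall m,
     ip (g m - f) (g m - f) <= (4 ^+ m * 2 ^+ m.+1)^-1.
Proof.
move=> g2 gC; have mg n := L2_measurable (g2 n).
pose h k x := (4 ^+ k * (g k.+1 x - g k x) ^+ 2)%:E.
have h0 k x : (0 <= h k x)%E.
  by rewrite lee_fin mulr_ge0 ?sqr_ge0 ?exprn_ge0.
have mh k : measurable_fun [set: T] (h k).
  apply/measurable_EFinP; apply: measurable_funM => //.
  by apply: measurable_funX; exact: measurable_funB.
pose G x := (\sum_(k <oo) h k x)%E.
have mG : measurable_fun [set: T] G.
  by apply: ge0_emeasurable_sum => // k x _ _.
have intG : mu.-integrable [set: T] G.
  apply/integrableP; split=> //.
  under eq_integral do (rewrite gee0_abs; last exact: nneseries_ge0).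
  rewrite integral_nneseries//.
  apply: (@le_lt_trans _ _ 1%:E); last by rewrite ltey.
  apply: le_trans (epsilon_trick0 xpredT (@ler01 R)).
  apply: lee_nneseries => [k _ _|k _]; first exact: integral_ge0.
  under eq_integral => x _ do rewrite /h EFinM expr2.
  have dk2 := L2B (g2 k.+1) (g2 k).
  rewrite ge0_integralZl_EFin ?exprn_ge0//; last 2 first.
    by move=> x _; rewrite lee_fin -expr2 sqr_ge0.
    by apply/measurable_EFinP; apply: measurable_funM; exact: measurable_funB.
  rewrite (ip_integral dk2 dk2) -EFinM lee_fin mulrC -ler_pdivlMr ?exprn_gt0//.
  apply: le_trans (gC _ _ (leqnSn k)) _.
  by rewrite mul1r invfM mulrC -natrX.
pose D := [set x | G x \is a fin_num].
have mD : measurable D.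
  by rewrite -[D]setTI; exact: emeasurable_fin_num.
have muD : mu (~` D) = 0.
  have [N [mN N0 DN]] := integrable_ae measurableT intG.
  apply/eqP; rewrite eq_le measure_ge0 andbT -N0 le_measure ?inE//.
    exact: measurableC.
  by move=> x nDx; apply: DN => /(_ I).
have gcvg x : D x -> cvgn (g ^~ x).
  move=> Dx; apply: (@cvg_of_summable_steps _ (fine (G x))) => k.
  rewrite -lee_fin fineK//; apply: le_trans (nneseries_lim_ge k.+1 _).
    by rewrite big_nat_recr//= leeDr// sume_ge0.
  by move=> n _ _; exact: h0.
pose F x := limn (g ^~ x).
have mF : measurable_fun D F.
  apply: (@measurable_fun_cvg _ _ _ D g) => // n.
  exact: measurable_funTS.
pose f := F \_ D.
have mf : measurable_fun [set: T] f by exact: (measurable_restrictT F mD).1.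
have fE x : D x -> f x = limn (g ^~ x) by move=> Dx; rewrite /f patchE mem_set.
have fatou_le m : (\int[mu]_x ((g m - f) x * (g m - f) x)%:E <=
    ((4 ^+ m * 2 ^+ m.+1)^-1)%:E)%E.
  have sq0 (k : T -> R) x : (0 <= (k x * k x)%:E)%E.
    by rewrite lee_fin -expr2 sqr_ge0.
  have msq (k : T -> R) : measurable_fun [set: T] k ->
      measurable_fun [set: T] (fun x => (k x * k x)%:E).
    by move=> mk; apply/measurable_EFinP; exact: measurable_funM.
  rewrite (ge0_negligible_integral _ _ _ _ muD)//; last 2 first.
    exact: measurableC.
    by apply: msq; exact: measurable_funB.
  rewrite setTD setCK.
  pose v k x := ((g m - g k) x * (g m - g k) x)%:E.
  have vlim x : D x -> limn_einf (v ^~ x) = ((g m - f) x * (g m - f) x)%:E.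
    move=> Dx; have := gcvg x Dx; move=> gx.
    have vx : v n x @[n --> \oo] --> ((g m - f) x * (g m - f) x)%:E.
      apply: cvg_EFin; first exact: nearW.
      rewrite /= -[(g m - f) x]/(g m x - f x) fE//.
      by apply: cvgM; apply: cvgB => //; exact: cvg_cst.
    rewrite is_cvg_limn_einfE; first exact/cvg_lim.
    by apply/cvg_ex; eexists; exact: vx.
  under eq_integral => x /[!inE] Dx do rewrite -vlim//.
  apply: le_trans (fatou mu mD _ _) _.
  - move=> n; apply: measurable_funTS; apply: msq; exact: measurable_funB.
  - by move=> n x _; exact: sq0.
  rewrite limn_einf_lim; apply: lime_le; first exact: is_cvg_einfs.
  exists m => // n /= mn.
  apply: (@le_trans _ _ (\int[mu]_(x in D) v n x)%E).
    by apply: ereal_inf_lbound; exists n => /=.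
  apply: (@le_trans _ _ (\int[mu]_x v n x)%E).
    apply: ge0_subset_integral => //.
      by apply: (msq (g m - g n)); exact: measurable_funB.
    by move=> x _; exact: sq0.
  have d2 := L2B (g2 m) (g2 n).
  rewrite (ip_integral d2 d2) lee_fin -(opprB (g n)).
  apply: le_trans (gC _ _ mn).
  by rewrite le_eqVlt; apply/orP; left; apply/eqP; apply: eq_Rintegral => x _;
    rewrite -[(- _) x]/(- ((g n - g m) x)) mulrNN.
have d2 m : g m - f \in L2.
  apply: L2P; first exact: measurable_funB.
  by apply: le_lt_trans (fatou_le m) _; rewrite ltey.
exists f; first by rewrite -(subKr (g 0%N) f); exact: L2B.
by move=> m; rewrite -lee_fin -ip_integral.
Qed.

Lemma ip_parallelogram f g : f \in L2 -> g \in L2 ->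
  ip (f - g) (f - g) = 2 * ip f f + 2 * ip g g
    - 4 * ip (2^-1 *: f + 2^-1 *: g) (2^-1 *: f + 2^-1 *: g).
Proof.
move=> f2 g2; have := ip_comb2 1 (-1) f2 g2.
by rewrite scale1r scaleN1r => ->; rewrite ip_comb2//; field.
Qed.

Lemma ip_eq0 f g : f \in L2 -> g \in L2 -> ip g g = 0 -> ip f g = 0.
Proof.
move=> f2 g2 g0; have := ip_cauchy_schwarz f2 g2; rewrite g0 mulr0.
by move=> fg0; apply/eqP; rewrite -sqrf_eq0 eq_le fg0 sqr_ge0.
Qed.

Lemma ip_cvg h f (f_ : nat -> T -> R) : h \in L2 -> f \in L2 ->
  (forall n, f_ n \in L2) -> ip (f_ n - f) (f_ n - f) @[n --> \oo] --> 0 ->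
  ip h (f_ n) @[n --> \oo] --> ip h f.
Proof.
move=> h2 f2 fn2 fn0.
have := ip_cvg0 h2 (fun n => L2B (fn2 n) f2) fn0.
move=> /(cvgD (cvg_cst (ip h f))); rewrite addr0; apply: cvg_trans.
apply: near_eq_cvg; apply: nearW => n /=.
by rewrite !fctE ipB// subrKC.
Qed.

Lemma closest_point (C : set (T -> R)) y : y \in L2 ->
  C `<=` [set z | z \in L2] -> C !=set0 ->
  (forall z w, C z -> C w -> C (2^-1 *: z + 2^-1 *: w)) ->
  exists (z_ : nat -> T -> R) z,
    [/\ forall n, C (z_ n), z \in L2,
        ip (z_ n - z) (z_ n - z) @[n --> \oo] --> 0 &
        forall w, C w -> ip (z - y) (z - y) <= ip (w - y) (w - y)].
Proof.
move=> y2 C2 [c0 Cc0] Cmid.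
pose J w := ip (w - y) (w - y).
pose m := inf [set J w | w in C].
have infJ : has_inf [set J w | w in C].
  split; first by exists (J c0), c0.
  by exists 0 => _ [w _ <-]; exact: ip_ge0.
have mJ w : C w -> m <= J w.
  by move=> Cw; apply: ge_inf; [exact: infJ.2|exists w].
have near_min e z w : C z -> C w -> J z <= m + e -> J w <= m + e ->
    ip (z - w) (z - w) <= 4 * e.
  move=> Cz Cw Jz Jw; have := mJ _ (Cmid _ _ Cz Cw).
  have z2 := C2 _ Cz; have w2 := C2 _ Cw.
  have := ip_parallelogram (L2B z2 y2) (L2B w2 y2).
  rewrite (_ : z - y - (w - y) = z - w); last by rewrite opprB addrA subrK.
  have -> : 2^-1 *: (z - y) + 2^-1 *: (w - y) = 2^-1 *: z + 2^-1 *: w - y.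
    apply/funext => x.
    have : 2^-1 * (z x - y x) + 2^-1 * (w x - y x) =
        2^-1 * z x + 2^-1 * w x - y x by field.
    exact.
  rewrite -/(J z) -/(J w) -/(J (2^-1 *: z + 2^-1 *: w)); lra.
pose dl n : R := (4 ^+ n * 2 ^+ n.+1)^-1.
have dl0 n : 0 < dl n by rewrite invr_gt0 mulr_gt0// exprn_gt0.
have dl_le k n : (k <= n)%N -> dl n <= dl k.
  move=> kn; rewrite lef_pV2 ?posrE ?mulr_gt0 ?exprn_gt0//.
  by rewrite ler_pM// ?exprn_ge0// ler_weXn2l// ler1n.
have /choice[z_ Hz] n : exists w, C w /\ J w <= m + dl n / 4.
  have [_ [w Cw <-] Jw] := inf_adherent (divr_gt0 (dl0 n) (ltr0n _ 4)) infJ.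
  by exists w; split=> //; exact: ltW.
have z_2 n : z_ n \in L2 by apply: C2; exact: (Hz n).1.
have [|z z2 z_z] := L2_complete_fast z_2.
  move=> k n kn; have := @near_min (dl k / 4) (z_ n) (z_ k) (Hz n).1 (Hz k).1.
  rewrite (_ : 4 * (dl k / 4) = dl k); last by field.
  apply; last exact: (Hz k).2.
  by rewrite (le_trans (Hz n).2)// lerD2l ler_pM2r ?invr_gt0// dl_le.
have dl_cvg : dl n @[n --> \oo] --> 0.
  apply: (@squeeze_cvgr _ _ _ _ (cst 0) (fun n => (2^-1) ^+ n)).
  - apply: nearW => n; rewrite ltW//= /dl exprVn.
    rewrite lef_pV2 ?posrE ?mulr_gt0 ?exprn_gt0//.
    rewrite -[leLHS]mul1r ler_pM ?exprn_ge0//.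
      by rewrite exprn_ege1// ler1n.
    by rewrite ler_weXn2l// ler1n.
  - exact: cvg_cst.
  - by apply: cvg_expr; rewrite ger0_norm ?invr_ge0// invf_lt1// ltr1n.
have zcvg : ip (z_ n - z) (z_ n - z) @[n --> \oo] --> 0.
  apply: (@squeeze_cvgr _ _ _ _ (cst 0) dl) => //; last exact: cvg_cst.
  by apply: nearW => n; rewrite ip_ge0 z_z.
exists z_, z; split=> //; first by move=> n; exact: (Hz n).1.
move=> w Cw; apply: le_trans (mJ w Cw).
have zy2 := L2B z2 y2.
have Jcvg : m + dl n / 4 - 2 * ip (z - y) (z_ n - z) @[n --> \oo] --> m.
  rewrite -[X in _ --> X]subr0 -[X in _ --> X - _]addr0.
  apply: cvgB.
    apply: cvgD; first exact: cvg_cst.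
    rewrite -[X in _ --> X](mul0r 4^-1); apply: cvgM => //; exact: cvg_cst.
  rewrite -[X in _ --> X](mulr0 2); apply: cvgM; first exact: cvg_cst.
  by apply: ip_cvg0 => // n; exact: L2B.
rewrite -(cvg_lim _ Jcvg)//; apply: limr_ge; first exact: cvgP Jcvg.
apply: nearW => n; have := (Hz n).2; rewrite /J.
have -> : z_ n - y = 1 *: (z - y) + 1 *: (z_ n - z).
  by rewrite !scale1r [RHS]addrC addrA subrK.
rewrite ip_comb2 ?L2B// !expr1n !mulr1 !mul1r.
have := ip_ge0 (z_ n - z); lra.
Qed.

End L2.

(** * The minimization problem *)

Lemma radon_comb (R : realType) (d : nat) (K : set (Rd R d)) (a b : R)
    (u w : radon K) : exists t : radon K, forall f, t f = a * u f + b * w f.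
Proof.
pose T (f : contfun K) : R := a * u f + b * w f.
have Tlin : linear_for *%R T.
  by move=> c f g; rewrite /T !linearP; ring.
pose TT : {scalar contfun K} := HB.pack T (GRing.isLinear.Build _ _ _ _ T Tlin).
have [cu Hu] := radon_bounded u; have [cw Hw] := radon_bounded w.
have TTb : exists c : R, forall f, `|TT f| <= c * supnorm f.
  exists (`|a| * cu + `|b| * cw) => f.
  rewrite (le_trans (ler_normD _ _))// !normrM mulrDl -!mulrA.
  by apply: lerD; apply: ler_wpM2l.
by exists (Radon TTb).
Qed.

Section Tracking.
Context (R : realType) (d : nat) (P : setting R d).
Local Notation K := (omega_c P).
Local Notation L2 := (Lfun (mu_o P) 2%:E).
Local Notation ip := (ip (mu_o P)).

Lemma starS_L2 h (v : contfun K) : starS h v -> h \in L2.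
Proof. by case=> phi [p [f [[]]]]. Qed.

Lemma opS_comb (a b : R) (u w t : radon K) y z :
  (forall f, t f = a * u f + b * w f) -> opS u y -> opS w z ->
  opS t (a *: y + b *: z).
Proof.
move=> tE [y2 uy] [z2 wz]; split=> [|h v hv]; first exact: L2_comb.
rewrite tE (uy h v hv) (wz h v hv); apply/esym; apply: ip_comb => //.
exact: starS_L2 hv.
Qed.

Lemma opS_limit (u : radon K) (u_ : nat -> radon K) z_ z :
  (forall n, opS (u_ n) (z_ n)) -> z \in L2 ->
  ip (z_ n - z) (z_ n - z) @[n --> \oo] --> 0 ->
  (forall v (l : R), u_ n v @[n --> \oo] --> l -> u v = l) -> opS u z.
Proof.
move=> uz z2 zz ulim; split=> // h v hv; apply: ulim.
have -> : (fun n => u_ n v) = (fun n => ip h (z_ n)).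
  by apply/funext => n; exact: (uz n).2.
by apply: ip_cvg => //; [exact: starS_L2 hv|move=> n; exact: (uz n).1].
Qed.

Lemma opS_eq_L2 (u : radon K) y z : opS u y -> z \in L2 ->
  ip (y - z) (y - z) = 0 -> opS u z.
Proof.
move=> [y2 uy] z2 yz; split=> // h v hv; have h2 := starS_L2 hv.
rewrite (uy h v hv) -[RHS]/(ip h z); apply/eqP.
by rewrite -subr_eq0 -[X in X - _]/(ip h y) -ipB// ip_eq0//; exact: L2B.
Qed.

Lemma opS0 : exists u : radon K, (forall f, u f = 0) /\ opS u (cst 0).
Proof.
have b0 : exists c : R, forall f,
    `|(\0 : {scalar contfun K}) f| <= c * supnorm f.
  by exists 0 => f; rewrite normr0 mul0r.
exists (Radon b0); split=> //; split.
  rewrite -[cst 0]/(0 : Rd R d -> R); apply: (Lfun_submod_closed _ _).1.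
  by rewrite lee_fin ler1n.
move=> h v _; rewrite /Rintegral (eq_integral (cst 0%E)) ?integral0// => x _.
by rewrite mulr0.
Qed.

Section Objective.
Variable yd : Rd R d -> R.
Hypothesis yd2 : yd \in L2.
Let J (z : Rd R d -> R) : R := ip (z - yd) (z - yd).

Let trackE (z : Rd R d -> R) : z \in L2 ->
  2^-1 * fine ('N[mu_o P]_(2%:E)[EFin \o (z - yd)]) ^+ 2 = 2^-1 * J z.
Proof. by move=> z2; rewrite ip_Lnorm//; exact: L2B. Qed.

Lemma objective_le (u : radon K) z : radon_nonneg u -> opS u z ->
  (objective yd u <= (2^-1 * J z)%:E)%E.
Proof.
move=> u0 uz; rewrite /objective /indicator_nonneg asboolT// adde0.
by apply: ereal_inf_lbound; exists z => //; rewrite trackE//; exact: uz.1.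
Qed.

Lemma le_objective (u : radon K) (r : R) :
  (forall z, radon_nonneg u -> opS u z -> r <= 2^-1 * J z) ->
  (r%:E <= objective yd u)%E.
Proof.
move=> rJ; rewrite /objective /indicator_nonneg; case: asboolP => [u0|nu0].
  rewrite adde0; apply: le_ereal_inf_tmp => _ [z uz <-].
  by rewrite lee_fin trackE ?(rJ z u0 uz)//; exact: uz.1.
rewrite addey ?leey// gt_eqF// (@lt_le_trans _ _ 0%E)//.
apply: le_ereal_inf_tmp => _ [z _ <-].
by rewrite lee_fin mulr_ge0 ?invr_ge0 ?sqr_ge0.
Qed.

Lemma objective_lty (u : radon K) : (objective yd u < +oo)%E ->
  radon_nonneg u /\ dom_S u.
Proof.
rewrite /objective /indicator_nonneg; case: asboolP => [u0|nu0].
  rewrite adde0 => /ereal_inf_lt[_ [z uz _] _].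
  by split=> //; exists z.
rewrite addey// gt_eqF// (@lt_le_trans _ _ 0%E)//.
apply: le_ereal_inf_tmp => _ [z _ <-].
by rewrite lee_fin mulr_ge0 ?invr_ge0 ?sqr_ge0.
Qed.

End Objective.
End Tracking.

Section Minimizer.
Context (R : realType) (d : nat) (P : setting R d).
Local Notation K := (omega_c P).
Local Notation L2 := (Lfun (mu_o P) 2%:E).
Local Notation ip := (ip (mu_o P)).
Hypothesis Kc : compact K.
Hypothesis slater : predual_slater P.
Variable yd : Rd R d -> R.
Hypothesis yd2 : yd \in L2.
Let J (z : Rd R d -> R) : R := ip (z - yd) (z - yd).

Let feasible : set (Rd R d -> R) :=
  [set z | exists2 u : radon K, radon_nonneg u & opS u z].

Lemma feasible_midpoint z w : feasible z -> feasible w ->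
  feasible (2^-1 *: z + 2^-1 *: w).
Proof.
move=> [u u0 uz] [t t0 tw]; have [s sE] := radon_comb 2^-1 2^-1 u t.
exists s; last exact: opS_comb sE uz tw.
apply/(radon_nonnegP Kc) => f f0; rewrite sE addr_ge0// mulr_ge0 ?invr_ge0//.
  exact: (radon_nonnegP Kc u).1.
exact: (radon_nonnegP Kc t).1.
Qed.

Lemma feasible_neq0 : feasible !=set0.
Proof.
have [u [u0 uz]] := opS0 P; exists (cst 0), u => //.
by apply/(radon_nonnegP Kc) => f _; rewrite u0.
Qed.

(* The Slater element turns weak convergence of the states into a bound on the
   total masses: [eps * u(1) <= u(v) = <h, z>]. *)
Lemma slater_mass_bound (u_ : nat -> radon K) z_ z :
  (forall n, radon_nonneg (u_ n)) -> (forall n, opS (u_ n) (z_ n)) ->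
  z \in L2 -> ip (z_ n - z) (z_ n - z) @[n --> \oo] --> 0 ->
  exists M : R, forall n, u_ n (contfun1 K) <= M.
Proof.
move=> u_0 uz z2 zz; have [h [v [eps [hv eps0 veps]]]] := slater.
have h2 := starS_L2 hv.
have hz : ip h (z_ n) @[n --> \oo] --> ip h z.
  by apply: ip_cvg => // n; exact: (uz n).1.
have [M [_ HM]] : bounded_fun (fun n => ip h (z_ n)).
  by apply: cvg_seq_bounded; apply/cvg_ex; exists (ip h z).
exists ((M + 1) / eps) => n; rewrite ler_pdivlMr// mulrC -functionalZ.
have uv : u_ n v <= M + 1.
  rewrite ((uz n).2 h v hv); apply: le_trans (ler_norm _) _.
  by apply: (HM (M + 1)) => //; rewrite ltrDl.
apply: le_trans uv.
apply: (functional_le ((radon_nonnegP Kc (u_ n)).1 (u_0 n))) => x Kx.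
by rewrite contfunZE contfun1E// mulr1; exact: veps.
Qed.

Lemma exists_optimal_pair : exists (u : radon K) z,
  [/\ radon_nonneg u, opS u z & forall w, feasible w -> J z <= J w].
Proof.
have [|z_ [z [Cz z2 zz zmin]]] := closest_point yd2 _ feasible_neq0
  feasible_midpoint.
  by move=> w [u _ []].
have /choice[u_ Hu] n : exists u : radon K, radon_nonneg u /\ opS u (z_ n).
  by have [u u0 uz] := Cz n; exists u.
have u_0 n := (Hu n).1; have uz n := (Hu n).2.
have [M uM] := slater_mass_bound u_0 uz z2 zz.
have [u u0 ulim] := radon_seq_compact Kc u_0 uM.
by exists u, z; split=> //; exact: opS_limit uz z2 zz ulim.
Qed.

Lemma optimal_pair_minimizer (u : radon K) z : radon_nonneg u -> opS u z ->
  (forall w, feasible w -> J z <= J w) -> minimizer yd u.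
Proof.
move=> u0 uz zmin t; apply: le_trans (objective_le yd2 u0 uz) _.
apply: le_objective => // w t0 tw; rewrite ler_pM2l ?invr_gt0//.
by apply: zmin; exists t.
Qed.

(* The state attained by any minimizer agrees almost everywhere with [z], by
   strict convexity of the norm. *)
Lemma minimizer_opS (u t : radon K) z : radon_nonneg u -> opS u z ->
  (forall w, feasible w -> J z <= J w) -> minimizer yd t -> opS t z.
Proof.
move=> u0 uz zmin tmin.
have tu := le_trans (tmin u) (objective_le yd2 u0 uz).
have [t0 [z0 tz0]] := objective_lty (le_lt_trans tu (ltey _)).
have tmid w1 w2 : opS t w1 -> opS t w2 -> opS t (2^-1 *: w1 + 2^-1 *: w2).
  by apply: opS_comb => f; field.
have [|w_ [w [tw_ w2 ww wmin]]] := @closest_point _ _ _ (mu_o P)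
  [set w | opS t w] yd yd2 _ (ex_intro _ z0 tz0) tmid.
  by move=> y [].
have tw : opS t w.
  apply: (opS_limit (u_ := fun=> t) tw_ w2 ww) => v l.
  by move=> /(cvg_lim (@Rhausdorff R)) <-; rewrite lim_cst.
have Jwz : J w <= J z.
  rewrite -(@ler_pM2l _ 2^-1) ?invr_gt0// -lee_fin; apply: le_trans tu.
  apply: le_objective => // y _ ty; rewrite ler_pM2l ?invr_gt0//.
  exact: wmin.
apply: (opS_eq_L2 tw uz.1).
have Fz : feasible z by exists u.
have Fw : feasible w by exists t.
have := zmin _ (feasible_midpoint Fw Fz).
have z2 := uz.1.
have := ip_parallelogram (L2B w2 yd2) (L2B z2 yd2).
have -> : 2^-1 *: (w - yd) + 2^-1 *: (z - yd) = 2^-1 *: w + 2^-1 *: z - yd.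
  apply/funext => x.
  have : 2^-1 * (w x - yd x) + 2^-1 * (z x - yd x) =
      2^-1 * w x + 2^-1 * z x - yd x by field.
  exact.
have -> : w - yd - (z - yd) = w - z by rewrite opprB addrA subrK.
rewrite -/(J w) -/(J z) -/(J (_ + _)) => e Jm; apply/eqP.
by rewrite eq_le ip_ge0 andbT e; move: Jwz Jm; lra.
Qed.

End Minimizer.

Theorem theorem3p3 (R : realType) (d : nat) (P : setting R d)
    (HP : standing_assumptions P)
    (yd : Rd R d -> R) (Hyd : yd \in Lfun (mu_o P) 2%:E)
    (Hslater : predual_slater P) :
  (exists ubar : radon (omega_c P), minimizer yd ubar /\ dom_S ubar) /\
  (S_injective P ->
   exists! ubar : radon (omega_c P), minimizer yd ubar).
Proof.
have Kc := omega_c_compact HP.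
have [u [z [u0 uz zmin]]] := exists_optimal_pair Kc Hslater Hyd.
have umin := optimal_pair_minimizer Hyd u0 uz zmin.
split; first by exists u; split=> //; exists z.
move=> Sinj; exists u; split=> // t tmin.
exact: Sinj uz (minimizer_opS Kc Hyd u0 uz zmin tmin).
Qed.
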